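(* Let $g=dr^2+f(r,\theta)^2\,d\theta^2$ be a Riemannian metric on $\mathbb{R}^2$ (written in polar coordinates $(r,\theta)$ about the origin) whose Gaussian curvature $K_g(r,\theta)=-\frac{f''(r,\theta)}{f(r,\theta)}$ is nonnegative everywhere. Let $u:\mathbb{R}^2\to\mathbb{R}$ be a harmonic function with respect to $g$, i.e. $\Delta_g u=0$. Suppose that for every $\delta>0$, \[ \liminf_{r\to\infty}\frac{M(u;r)}{r^{1+\delta}}=0 . \] Then $u$ has at most linear growth: there is a constant $C>0$ such that $|u(r,\theta)|\le C(1+r)$ for all $(r,\theta)$.
   Context: Here $f:(0,\infty)\times[0,2\pi]\to(0,\infty)$ is smooth with $f(r,0)=f(r,2\pi)$, $\lim_{r\to0^+}f(r,\theta)=0$ and $\lim_{r\to0^+}f'(r,\theta)=1$, where $'$ denotes $\partial/\partial r$; thus $g$ is a smooth metric on $\mathbb{R}^2$ for which polar coordinates about the origin are geodesic polar coordinates, and $r$ is the $g$-distance to the origin. The Laplacian of $g$ is \[ \Delta_g=\frac{\partial^2}{\partial r^2}+\frac{f'}{f}\frac{\partial}{\partial r}+\frac{1}{f^2}\frac{\partial^2}{\partial\theta^2}-\frac{f_\theta}{f^3}\frac{\partial}{\partial\theta},\qquad f_\theta=\frac{\partial f}{\partial\theta}. \] For a continuous function $v$, $M(v;r)=\sup_{\theta\in[0,2\pi)}|v(r,\theta)|$. *)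

(* Defs.v *)
From Stdlib Require Import Reals.
From Coquelicot Require Import Coquelicot.
Open Scope R_scope.

Definition d1 (h : R -> R -> R) : R -> R -> R :=
  fun x y => Derive (fun t => h t y) x.
Definition d2 (h : R -> R -> R) : R -> R -> R :=
  fun x y => Derive (fun t => h x t) y.

Fixpoint CkOn (k : nat) (D : R -> R -> Prop) (h : R -> R -> R) : Prop :=
  match k with
  | O => forall x y, D x y ->
           continuous (fun p : R * R => h (fst p) (snd p)) (x, y)
  | S k' => (forall x y, D x y ->
               continuous (fun p : R * R => h (fst p) (snd p)) (x, y) /\
               ex_derive (fun t => h t y) x /\ ex_derive (fun t => h x t) y)
            /\ CkOn k' D (d1 h) /\ CkOn k' D (d2 h)
  end.

Definition SmoothOn (D : R -> R -> Prop) (h : R -> R -> R) : Prop :=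
  forall k, CkOn k D h.

Definition pos_r : R -> R -> Prop := fun r _ => 0 < r.
Definition whole_plane : R -> R -> Prop := fun _ _ => True.

(* Hypotheses on the warping function f(r,theta) of g = dr^2 + f^2 dtheta^2
   (theta ranges over R, f being 2*PI-periodic in theta). *)
Definition polar_metric_fun (f : R -> R -> R) : Prop :=
  SmoothOn pos_r f /\
  (forall r th, 0 < r -> 0 < f r th) /\
  (forall r th, 0 < r -> f r (th + 2 * PI) = f r th) /\
  (forall th, filterlim (fun r => f r th) (at_right 0) (locally 0)) /\
  (forall th, filterlim (fun r => d1 f r th) (at_right 0) (locally 1)).

Definition gauss_curv (f : R -> R -> R) (r th : R) : R :=
  - d1 (d1 f) r th / f r th.

Definition polar (u : R -> R -> R) : R -> R -> R :=
  fun r th => u (r * cos th) (r * sin th).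

Definition lap_g (f v : R -> R -> R) (r th : R) : R :=
  d1 (d1 v) r th + d1 f r th / f r th * d1 v r th
  + / (f r th ^ 2) * d2 (d2 v) r th
  - d2 f r th / (f r th ^ 3) * d2 v r th.

(* M(v; r) = sup_theta |v(r,theta)| (v continuous and 2pi-periodic in theta,
   so the sup is finite). *)
Definition Mmax (v : R -> R -> R) (r : R) : R :=
  real (Lub_Rbar (fun y => exists th, 0 <= th < 2 * PI /\ y = Rabs (v r th))).

Definition liminf_pinfty_eq (h : R -> R) (l : R) : Prop :=
  (forall eps, 0 < eps -> exists R0, forall r, R0 < r -> l - eps < h r) /\
  (forall eps, 0 < eps -> forall R0, exists r, R0 < r /\ h r < l + eps).

(* Main.v *)
(** Write [v] for [u] in polar coordinates and [w = v_r^2 + v_theta^2 / f^2] for the squared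
    gradient.  In dimension two the Bochner formula reads
    [Delta w = 4 (P^2 + S^2) + 2 K w] with [|grad w|^2 = 4 w (P^2 + S^2)], so for [K >= 0] the
    function [log w] is subharmonic, while [r f' <= f] (concavity) makes [log r] superharmonic.
    Hence on an annulus [1 <= r <= R] the maximum principle bounds [w / r^(2 delta)] by its
    boundary values.  The value at [r = R] is controlled by Bernstein's gradient estimate
    [w(R / 2) <= C (1 + M(u; R)^2 / R^2)], obtained on the same annulus.  Letting [delta] tend
    to [0] shows that the gradient is bounded. *)

From Stdlib Require Import Reals ZArith Lia Lra.
From Stdlib Require Import Classical ClassicalEpsilon FunctionalExtensionality.
From Coquelicot Require Import Coquelicot.
Require Import Defs.
Open Scope R_scope.

(** The polar form of the metric degenerates at the origin, so every comparison starts from the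
    circle [r = 1]; the price is a boundary term there, which is a constant by compactness. A
    maximum principle read off from the second-derivative test needs strict inequalities, whereas
    subharmonicity is only weak. The terms [/ r] and [2 / r] are added for this purpose:
    [f' / f <= 1 / r] gives [Delta (1 / r) >= 1 / r^3]. Since [w] may vanish, [log w] is never
    formed; the exponential [w * r^(- 2 delta) * exp (2 / r)] of the comparison function is used
    instead, and [w] is positive wherever this exceeds a nonnegative bound. A lower limit controls
    [u] only on some circles, which is enough because the maximum principle asks for boundary values
    on a single outer circle. The resulting constant depends neither on [delta] nor on that circle,
    so each point may be given its own [delta]. *)

(** * Compactness and the maximum principle on an annulus *)

Lemma local_max_deriv2 (g g1 : R -> R) (x a b g2 : R) :
  a < x < b ->
  (forall t, a < t < b -> is_derive g t (g1 t)) ->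
  is_derive g1 x g2 ->
  (forall t, a < t < b -> g t <= g x) ->
  g1 x = 0 /\ g2 <= 0.
Proof.
  intros Hx Hg Hg1 Hmax.
  assert (H0 : g1 x = 0).
  { assert (pr : derivable_pt g x).
    { exists (g1 x). apply is_derive_Reals, Hg, Hx. }
    rewrite <- (deriv_maximum g a b x pr) by (try lra; intros; apply Hmax; lra).
    symmetry. apply derive_pt_eq_0, is_derive_Reals, Hg, Hx. }
  split; [exact H0 |].
  destruct (Rle_lt_dec g2 0) as [|Hpos]; [assumption |].
  exfalso.
  apply is_derive_Reals in Hg1.
  destruct (Hg1 g2 Hpos) as [d Hd].
  set (h := Rmin (d / 2) ((b - x) / 2)).
  assert (Hh : 0 < h) by (apply Rmin_pos; [generalize (cond_pos d) |]; lra).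
  assert (Hhd : h < d) by (generalize (Rmin_l (d / 2) ((b - x) / 2)) (cond_pos d); fold h; lra).
  assert (Hhb : x + h < b) by (generalize (Rmin_r (d / 2) ((b - x) / 2)); fold h; lra).
  destruct (MVT_cor2 g g1 x (x + h)) as [c [Hc1 Hc2]]; [lra | |].
  { intros c Hc. apply is_derive_Reals, Hg. lra. }
  assert (g1 c > 0).
  { specialize (Hd (c - x)).
    assert (Hd' : Rabs ((g1 (x + (c - x)) - g1 x) / (c - x) - g2) < g2).
    { apply Hd; [lra |]. rewrite Rabs_right; lra. }
    replace (x + (c - x)) with c in Hd' by ring.
    rewrite H0 in Hd'. apply Rabs_def2 in Hd' as [_ Hd'].
    assert (Hq : 0 < (g1 c - 0) / (c - x)) by lra.
    apply (Rmult_lt_compat_r (c - x)) in Hq; [|lra].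
    replace ((g1 c - 0) / (c - x) * (c - x)) with (g1 c) in Hq by (field; lra).
    lra. }
  generalize (Hmax (x + h) ltac:(lra)). nra.
Qed.

Definition jcont (h : R -> R -> R) (x y : R) : Prop :=
  continuous (fun p : R * R => h (fst p) (snd p)) (x, y).

Lemma jcont_2d (h : R -> R -> R) x y : jcont h x y <-> continuity_2d_pt h x y.
Proof. unfold jcont, continuous. symmetry. apply continuity_2d_pt_filterlim. Qed.

(** The gauge of the cover is kept below [/ (1 + Rabs (h x y))], so a uniform lower bound on the
    gauge is at the same time a bound on [h] at the centres, and [h] varies by less than 1 around
    each centre. *)
Lemma rectangle_bounded (h : R -> R -> R) (a b c d : R) :
  (forall x y, a <= x <= b -> c <= y <= d -> jcont h x y) ->
  exists B, forall x y, a <= x <= b -> c <= y <= d -> Rabs (h x y) <= B.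
Proof.
  intros Hc.
  assert (Hdl : forall x y, exists e : posreal, e <= / (1 + Rabs (h x y)) /\
    (a <= x <= b -> c <= y <= d -> forall x' y', Rabs (x' - x) < e -> Rabs (y' - y) < e ->
      Rabs (h x' y' - h x y) < 1)).
  { intros x y.
    assert (Hp : 0 < / (1 + Rabs (h x y)))
      by (apply Rinv_0_lt_compat; generalize (Rabs_pos (h x y)); lra).
    destruct (classic (a <= x <= b /\ c <= y <= d)) as [[Hx Hy]|Hn].
    - destruct (proj1 (jcont_2d h x y) (Hc x y Hx Hy) (mkposreal 1 Rlt_0_1)) as [e He].
      exists (mkposreal (Rmin e (/ (1 + Rabs (h x y)))) (Rmin_pos _ _ (cond_pos e) Hp)).
      simpl. split; [apply Rmin_r |].
      intros _ _ x' y' H1 H2. apply He; eapply Rlt_le_trans; eauto; apply Rmin_l.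
    - exists (mkposreal _ Hp). simpl. split; [lra |]. intros; tauto. }
  set (delta := fun x y => proj1_sig (constructive_indefinite_description _ (Hdl x y))).
  assert (Hdelta : forall x y, delta x y <= / (1 + Rabs (h x y)) /\
    (a <= x <= b -> c <= y <= d -> forall x' y', Rabs (x' - x) < delta x y ->
      Rabs (y' - y) < delta x y -> Rabs (h x' y' - h x y) < 1)).
  { intros x y. unfold delta. apply proj2_sig. }
  destruct (compactness_value_2d a b c d delta) as [e He].
  exists (/ e + 1). intros x y Hx Hy.
  apply NNPP. intros Hn. apply (He x y Hx Hy). intros (p & q & Hp & Hq & H1 & H2 & H3).
  apply Hn.
  destruct (Hdelta p q) as [Hd1 Hd2].
  specialize (Hd2 Hp Hq x y H1 H2).
  assert (Hpos : 0 < 1 + Rabs (h p q)) by (generalize (Rabs_pos (h p q)); lra).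
  assert (Hle : 1 + Rabs (h p q) <= / e).
  { rewrite <- (Rinv_inv (1 + Rabs (h p q))).
    apply Rinv_le_contravar; [apply cond_pos | lra]. }
  generalize (Rabs_triang (h x y - h p q) (h p q)).
  replace (h x y - h p q + h p q) with (h x y) by ring. lra.
Qed.

Lemma jcont_comp (g : R -> R) (h : R -> R -> R) x y :
  continuous g (h x y) -> jcont h x y -> jcont (fun x y => g (h x y)) x y.
Proof.
  intros Hg Hh. unfold jcont in *.
  exact (continuous_comp (fun p : R * R => h (fst p) (snd p)) g (x, y) Hh Hg).
Qed.

Lemma jcont_fst (g : R -> R) x y : continuous g x -> jcont (fun x _ => g x) x y.
Proof.
  intros Hg. apply (continuous_comp (@fst R R) g (x, y)); [apply continuous_fst | exact Hg].
Qed.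

Lemma jcont_snd (g : R -> R) x y : continuous g y -> jcont (fun _ y => g y) x y.
Proof.
  intros Hg. apply (continuous_comp (@snd R R) g (x, y)); [apply continuous_snd | exact Hg].
Qed.

Lemma jcont_plus (h1 h2 : R -> R -> R) x y :
  jcont h1 x y -> jcont h2 x y -> jcont (fun x y => h1 x y + h2 x y) x y.
Proof.
  intros H1 H2. exact (continuous_plus (V := R_NormedModule) _ _ _ H1 H2).
Qed.

Lemma jcont_mult (h1 h2 : R -> R -> R) x y :
  jcont h1 x y -> jcont h2 x y -> jcont (fun x y => h1 x y * h2 x y) x y.
Proof.
  intros H1 H2. exact (continuous_mult (K := R_AbsRing) _ _ _ H1 H2).
Qed.

Lemma jcont_sqr (h : R -> R -> R) x y : jcont h x y -> jcont (fun x y => h x y ^ 2) x y.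
Proof.
  apply (jcont_comp (fun z => z ^ 2)).
  apply (ex_derive_continuous (V := R_NormedModule)). auto_derive; exact I.
Qed.

Lemma jcont_inv (h : R -> R -> R) x y :
  h x y <> 0 -> jcont h x y -> jcont (fun x y => / h x y) x y.
Proof.
  intros Hn. apply (jcont_comp (fun z => / z)).
  apply (ex_derive_continuous (V := R_NormedModule)). auto_derive; auto.
Qed.

(** If the supremum [S] were not attained, [/ (S - h)] would be continuous, hence bounded, and [S]
    could be lowered. *)
Lemma rectangle_max (h : R -> R -> R) (a b c d : R) :
  a <= b -> c <= d ->
  (forall x y, a <= x <= b -> c <= y <= d -> jcont h x y) ->
  exists x0 y0, a <= x0 <= b /\ c <= y0 <= d /\
    forall x y, a <= x <= b -> c <= y <= d -> h x y <= h x0 y0.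
Proof.
  intros Hab Hcd Hc.
  set (E := fun z => exists x y, a <= x <= b /\ c <= y <= d /\ z = h x y).
  destruct (completeness E) as [S [HS1 HS2]].
  { destruct (rectangle_bounded h a b c d Hc) as [B HB].
    exists B. intros z (x & y & Hx & Hy & ->).
    eapply Rle_trans; [apply Rle_abs | auto]. }
  { exists (h a c), a, c. repeat split; lra. }
  assert (HS : forall x y, a <= x <= b -> c <= y <= d -> h x y <= S).
  { intros x y Hx Hy. apply HS1. exists x, y. auto. }
  apply NNPP. intros Hn.
  assert (Hlt : forall x y, a <= x <= b -> c <= y <= d -> h x y < S).
  { intros x y Hx Hy. destruct (HS x y Hx Hy) as [|Heq]; [assumption |].
    exfalso. apply Hn. exists x, y. rewrite Heq. auto. }
  destruct (rectangle_bounded (fun x y => / (S + - h x y)) a b c d) as [B HB].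
  { intros x y Hx Hy. generalize (Hlt x y Hx Hy). intros Hl.
    apply (jcont_inv (fun x y => S + - h x y)); [lra |].
    apply (jcont_comp (fun z => S + - z)); [| auto].
    apply (ex_derive_continuous (V := R_NormedModule)). auto_derive; exact I. }
  assert (HB1 : forall x y, a <= x <= b -> c <= y <= d -> / (S + - h x y) <= Rabs B + 1).
  { intros x y Hx Hy. generalize (HB x y Hx Hy) (Rle_abs (/ (S + - h x y))) (Rle_abs B). lra. }
  assert (HBp : 0 < Rabs B + 1) by (generalize (Rabs_pos B); lra).
  assert (Hub : S <= S - / (Rabs B + 1)).
  { apply HS2. intros z (x & y & Hx & Hy & ->).
    generalize (HB1 x y Hx Hy) (Hlt x y Hx Hy). intros H1 H2.
    apply Rinv_le_contravar in H1; [| apply Rinv_0_lt_compat; lra].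
    rewrite Rinv_inv in H1. lra. }
  generalize (Rinv_0_lt_compat _ HBp). lra.
Qed.

Definition periodic2 (h : R -> R) : Prop := forall th, h (th + 2 * PI) = h th.

Lemma periodic2_reduce (h : R -> R) (th : R) :
  periodic2 h -> exists th', 0 <= th' < 2 * PI /\ h th = h th'.
Proof.
  intros Hp.
  assert (Hn : forall n th, h (th + INR n * (2 * PI)) = h th).
  { induction n as [|n IH]; intros t.
    - simpl. f_equal. ring.
    - rewrite S_INR. replace (t + (INR n + 1) * (2 * PI)) with (t + INR n * (2 * PI) + 2 * PI) by ring.
      rewrite Hp. apply IH. }
  assert (Hz : forall z th, h (th + IZR z * (2 * PI)) = h th).
  { intros z t. destruct (Z_le_dec 0 z) as [H|H].
    - rewrite <- (Z2Nat.id z H), <- INR_IZR_INZ. apply Hn.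
    - rewrite <- (Hn (Z.to_nat (- z)) (t + IZR z * (2 * PI))).
      f_equal. rewrite INR_IZR_INZ, Z2Nat.id, opp_IZR by lia. ring. }
  assert (HPI := PI_RGT_0).
  destruct (base_Int_part (th / (2 * PI))) as [H1 H2].
  set (z := Int_part (th / (2 * PI))) in *.
  exists (th - IZR z * (2 * PI)).
  assert (Heq : th = th / (2 * PI) * (2 * PI)) by (field; lra).
  split.
  - set (q := th / (2 * PI)) in *. rewrite Heq. split; nra.
  - rewrite <- (Hz z (th - IZR z * (2 * PI))). f_equal. ring.
Qed.

Lemma annulus_max (h : R -> R -> R) (a b : R) :
  a <= b ->
  (forall r th, a <= r <= b -> jcont h r th) ->
  (forall r, a <= r <= b -> periodic2 (h r)) ->
  exists r0 th0, a <= r0 <= b /\ forall r th, a <= r <= b -> h r th <= h r0 th0.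
Proof.
  intros Hab Hc Hp.
  destruct (rectangle_max h a b 0 (2 * PI)) as (r0 & th0 & Hr0 & _ & Hmax); auto.
  { generalize PI_RGT_0; lra. }
  exists r0, th0. split; [assumption |]. intros r th Hr.
  destruct (periodic2_reduce (h r) th (Hp r Hr)) as (th' & Hth' & ->).
  apply Hmax; [assumption | lra].
Qed.

(** No differential operator appears: the last hypothesis asks for a contradiction at an interior
    maximum, where the test conditions and also [B < h] are available. *)
Lemma annulus_max_principle (h h1 h11 h2 h22 : R -> R -> R) (a b B : R) :
  a <= b ->
  (forall r th, a <= r <= b -> jcont h r th) ->
  (forall r, a <= r <= b -> periodic2 (h r)) ->
  (forall r th, a < r < b -> is_derive (fun t => h t th) r (h1 r th)) ->
  (forall r th, a < r < b -> is_derive (fun t => h1 t th) r (h11 r th)) ->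
  (forall r th, a < r < b -> is_derive (fun t => h r t) th (h2 r th)) ->
  (forall r th, a < r < b -> is_derive (fun t => h2 r t) th (h22 r th)) ->
  (forall th, h a th <= B) -> (forall th, h b th <= B) ->
  (forall r th, a < r < b -> B < h r th -> h1 r th = 0 -> h2 r th = 0 ->
     h11 r th <= 0 -> h22 r th <= 0 -> False) ->
  forall r th, a <= r <= b -> h r th <= B.
Proof.
  intros Hab Hc Hp D1 D11 D2 D22 Ba Bb Hno r th Hr.
  destruct (annulus_max h a b Hab Hc Hp) as (r0 & th0 & Hr0 & Hmax).
  apply Rle_trans with (h r0 th0); [auto |].
  destruct (Rle_lt_dec (h r0 th0) B) as [|HB]; [assumption |]. exfalso.
  destruct (Req_dec r0 a) as [->|Ha]; [generalize (Ba th0); lra |].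
  destruct (Req_dec r0 b) as [->|Hb]; [generalize (Bb th0); lra |].
  destruct (local_max_deriv2 (fun t => h t th0) (fun t => h1 t th0) r0 a b (h11 r0 th0));
    try (intros; auto; apply Hmax); try lra; auto.
  { apply D11; lra. }
  (* The angle runs over the whole line and has no boundary, so any interval around [th0] serves. *)
  destruct (local_max_deriv2 (fun t => h r0 t) (fun t => h2 r0 t) th0 (th0 - 1) (th0 + 1) (h22 r0 th0));
    try (intros; auto; apply Hmax); try lra.
  { intros t _. apply D2; lra. }
  { apply D22; lra. }
  eapply Hno; eauto. lra.
Qed.

(** * Functions of class [C^k] and their pullback to polar coordinates *)

Lemma CkOn_jcont k D h x y : CkOn k D h -> D x y -> jcont h x y.
Proof. destruct k; intros H HD; [apply H, HD | apply (proj1 H), HD]. Qed.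

Lemma CkOn_is_derive1 k D h x y :
  CkOn (S k) D h -> D x y -> is_derive (fun t => h t y) x (d1 h x y).
Proof. intros [H _] HD. apply Derive_correct, (H x y HD). Qed.

Lemma CkOn_is_derive2 k D h x y :
  CkOn (S k) D h -> D x y -> is_derive (fun t => h x t) y (d2 h x y).
Proof. intros [H _] HD. apply Derive_correct, (H x y HD). Qed.

Lemma CkOn_pred k D h : CkOn (S k) D h -> CkOn k D h.
Proof.
  revert h. induction k as [|k IH]; intros h H.
  - intros x y HD. apply (proj1 H x y HD).
  - destruct H as (H & H1 & H2). split; [exact H |]. split; apply IH; assumption.
Qed.

(** [CkOn] iterates the total functions [d1] and [d2], so closed forms can replace them only as
    equal functions; on the whole plane extensionality provides this. *)
Lemma CkOn_S_whole k h g1 g2 :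
  (forall x y, jcont h x y) ->
  (forall x y, is_derive (fun t => h t y) x (g1 x y)) ->
  (forall x y, is_derive (fun t => h x t) y (g2 x y)) ->
  CkOn k whole_plane g1 -> CkOn k whole_plane g2 -> CkOn (S k) whole_plane h.
Proof.
  intros Hc H1 H2 C1 C2.
  assert (E1 : d1 h = g1).
  { extensionality x; extensionality y. apply is_derive_unique, H1. }
  assert (E2 : d2 h = g2).
  { extensionality x; extensionality y. apply is_derive_unique, H2. }
  split; [| rewrite E1, E2; auto].
  intros x y _. split; [apply Hc |]. split; eexists; [apply H1 | apply H2].
Qed.

Lemma CkOn_plus k h g :
  CkOn k whole_plane h -> CkOn k whole_plane g ->
  CkOn k whole_plane (fun x y => h x y + g x y).
Proof.
  revert h g. induction k as [|k IH]; intros h g Hh Hg.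
  - intros x y HD. apply jcont_plus; [apply Hh | apply Hg]; exact I.
  - apply (CkOn_S_whole k _ (fun x y => d1 h x y + d1 g x y) (fun x y => d2 h x y + d2 g x y)).
    + intros x y. apply jcont_plus; eapply CkOn_jcont; eauto; exact I.
    + intros x y. apply @is_derive_plus; eapply CkOn_is_derive1; eauto; exact I.
    + intros x y. apply @is_derive_plus; eapply CkOn_is_derive2; eauto; exact I.
    + apply IH; [apply Hh | apply Hg].
    + apply IH; [apply Hh | apply Hg].
Qed.

Lemma CkOn_mult k h g :
  CkOn k whole_plane h -> CkOn k whole_plane g ->
  CkOn k whole_plane (fun x y => h x y * g x y).
Proof.
  revert h g. induction k as [|k IH]; intros h g Hh Hg.
  - intros x y HD. apply jcont_mult; [apply Hh | apply Hg]; exact I.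
  - apply (CkOn_S_whole k _ (fun x y => d1 h x y * g x y + h x y * d1 g x y)
      (fun x y => d2 h x y * g x y + h x y * d2 g x y)).
    + intros x y. apply jcont_mult; eapply CkOn_jcont; eauto; exact I.
    + intros x y.
      apply (is_derive_mult (fun t => h t y) (fun t => g t y) x (d1 h x y) (d1 g x y));
        try (eapply CkOn_is_derive1; eauto; exact I). intros; apply Rmult_comm.
    + intros x y.
      apply (is_derive_mult (fun t => h x t) (fun t => g x t) y (d2 h x y) (d2 g x y));
        try (eapply CkOn_is_derive2; eauto; exact I). intros; apply Rmult_comm.
    + apply CkOn_plus; apply IH; try apply Hh; try apply Hg; apply CkOn_pred; assumption.
    + apply CkOn_plus; apply IH; try apply Hh; try apply Hg; apply CkOn_pred; assumption.
Qed.

Lemma CkOn_const k c : CkOn k whole_plane (fun _ _ => c).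
Proof.
  revert c. induction k as [|k IH]; intros c.
  - intros x y _. apply continuous_const.
  - apply (CkOn_S_whole k _ (fun _ _ => 0) (fun _ _ => 0)); auto.
    + intros x y. apply continuous_const.
    + intros x y. apply @is_derive_const.
    + intros x y. apply @is_derive_const.
Qed.

Lemma CkOn_fst k : CkOn k whole_plane (fun x _ => x).
Proof.
  assert (Hc : forall x y, jcont (fun x _ => x) x y) by (intros; apply jcont_fst, continuous_id).
  destruct k as [|k].
  - intros x y _. apply Hc.
  - apply (CkOn_S_whole k _ (fun _ _ => 1) (fun _ _ => 0)); auto using CkOn_const.
    + intros x y. apply @is_derive_id.
    + intros x y. apply @is_derive_const.
Qed.

(** The factor [c] absorbs the sign in the derivative of [cos], which makes the pair of statements
    closed under differentiation. *)
Lemma CkOn_cos_sin k c :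
  CkOn k whole_plane (fun _ y => c * cos y) /\ CkOn k whole_plane (fun _ y => c * sin y).
Proof.
  assert (Hcos : forall c x y, jcont (fun _ y => c * cos y) x y).
  { intros. apply jcont_snd, (ex_derive_continuous (V := R_NormedModule)). auto_derive; exact I. }
  assert (Hsin : forall c x y, jcont (fun _ y => c * sin y) x y).
  { intros. apply jcont_snd, (ex_derive_continuous (V := R_NormedModule)). auto_derive; exact I. }
  revert c. induction k as [|k IH]; intros c.
  - split; intros x y _; [apply Hcos | apply Hsin].
  - split.
    + apply (CkOn_S_whole k _ (fun _ _ => 0) (fun _ y => - c * sin y)); auto using CkOn_const.
      * intros x y. apply @is_derive_const.
      * intros x y. auto_derive; [exact I | ring].
      * apply IH.
    + apply (CkOn_S_whole k _ (fun _ _ => 0) (fun _ y => c * cos y)); auto using CkOn_const.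
      * intros x y. apply @is_derive_const.
      * intros x y. auto_derive; [exact I | ring].
      * apply IH.
Qed.

Lemma CkOn_cos k : CkOn k whole_plane (fun _ y => cos y).
Proof.
  replace (fun _ y : R => cos y) with (fun _ y : R => 1 * cos y).
  - apply CkOn_cos_sin.
  - extensionality x; extensionality y; ring.
Qed.

Lemma CkOn_sin k : CkOn k whole_plane (fun _ y => sin y).
Proof.
  replace (fun _ y : R => sin y) with (fun _ y : R => 1 * sin y).
  - apply CkOn_cos_sin.
  - extensionality x; extensionality y; ring.
Qed.

Lemma is_derive_comp2 (h : R -> R -> R) (p q : R -> R) (t p' q' : R) :
  CkOn 1 whole_plane h -> is_derive p t p' -> is_derive q t q' ->
  is_derive (fun t => h (p t) (q t)) t (d1 h (p t) (q t) * p' + d2 h (p t) (q t) * q').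
Proof.
  intros Hh Hp Hq. apply is_derive_Reals.
  apply derivable_pt_lim_comp_2d; [| now apply is_derive_Reals | now apply is_derive_Reals].
  apply filterdiff_differentiable_pt_lim.
  apply (is_derive_filterdiff h (p t) (q t) (d1 h) (d2 h (p t) (q t))).
  - apply filter_forall. intros z. eapply CkOn_is_derive1; [exact Hh | exact I].
  - eapply CkOn_is_derive2; [exact Hh | exact I].
  - exact (CkOn_jcont 0 whole_plane (d1 h) _ _ (proj1 (proj2 Hh)) I).
Qed.

Lemma is_derive_polar1 h r th : CkOn 1 whole_plane h ->
  is_derive (fun t => polar h t th) r (cos th * polar (d1 h) r th + sin th * polar (d2 h) r th).
Proof.
  intros Hh. unfold polar.
  evar_last.
  - apply (is_derive_comp2 h (fun t => t * cos th) (fun t => t * sin th) r (cos th) (sin th) Hh);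
      auto_derive; auto; ring.
  - simpl; ring.
Qed.

(** The sign is written as [-1 * sin th] to match the form [c * sin y] of [CkOn_cos_sin]. *)
Lemma is_derive_polar2 h r th : CkOn 1 whole_plane h ->
  is_derive (fun t => polar h r t) th
    (r * (-1 * sin th) * polar (d1 h) r th + r * cos th * polar (d2 h) r th).
Proof.
  intros Hh. unfold polar.
  evar_last.
  - apply (is_derive_comp2 h (fun t => r * cos t) (fun t => r * sin t) th (- r * sin th) (r * cos th) Hh);
      auto_derive; auto; ring.
  - simpl; ring.
Qed.

Lemma CkOn_le_1 k D h : CkOn (S k) D h -> CkOn 1 D h.
Proof. induction k as [|k IH]; auto using CkOn_pred. Qed.

(** Both derivatives of [polar h] combine [polar (d1 h)] and [polar (d2 h)] with smooth
    coefficients, so the induction runs over all [h] at once. The range [r <= 0] is included, which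
    later gives continuity up to the origin. *)
Lemma CkOn_polar k h : CkOn k whole_plane h -> CkOn k whole_plane (polar h).
Proof.
  assert (Hc : forall h, (forall x y, jcont h x y) -> forall r th, jcont (polar h) r th).
  { intros g Hg r th.
    apply (continuous_comp_2 (fun z : R * R => fst z * cos (snd z)) (fun z : R * R => fst z * sin (snd z)) g).
    - exact (CkOn_jcont 0 whole_plane _ r th (CkOn_mult 0 _ _ (CkOn_fst 0) (CkOn_cos 0)) I).
    - exact (CkOn_jcont 0 whole_plane _ r th (CkOn_mult 0 _ _ (CkOn_fst 0) (CkOn_sin 0)) I).
    - apply Hg. }
  revert h. induction k as [|k IH]; intros h Hh.
  - intros r th _. apply Hc. intros x y. apply Hh. exact I.
  - eapply CkOn_S_whole.
    + apply Hc. intros x y. eapply CkOn_jcont; eauto. exact I.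
    + intros r th. apply is_derive_polar1. eapply CkOn_le_1; eauto.
    + intros r th. apply is_derive_polar2. eapply CkOn_le_1; eauto.
    + destruct Hh as (_ & H1 & H2).
      apply CkOn_plus; apply CkOn_mult; auto using CkOn_cos, CkOn_sin.
    + destruct Hh as (_ & H1 & H2).
      apply CkOn_plus; apply CkOn_mult; auto; apply CkOn_mult; auto using CkOn_fst, CkOn_cos.
      apply CkOn_cos_sin.
Qed.

Lemma CkOn_Schwarz k (D : R -> R -> Prop) h x y :
  locally_2d D x y -> CkOn (S (S k)) D h -> d1 (d2 h) x y = d2 (d1 h) x y.
Proof.
  intros HD Hh.
  assert (Hxy := locally_2d_singleton _ _ _ HD).
  apply Schwarz.
  - eapply locally_2d_impl; [| exact HD]. apply locally_2d_forall. intros p q Hpq.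
    destruct Hh as (H & (H1 & _) & (H2 & _)).
    split; [apply (H p q Hpq) |]. split; [apply (H p q Hpq) |].
    split; [apply (H2 p q Hpq) | apply (H1 p q Hpq)].
  - apply (jcont_2d (d1 (d2 h))). eapply CkOn_jcont; [apply Hh | exact Hxy].
  - apply (jcont_2d (d2 (d1 h))). eapply CkOn_jcont; [apply Hh | exact Hxy].
Qed.

Lemma pos_r_open r th : 0 < r -> locally_2d pos_r r th.
Proof.
  intros Hr. exists (mkposreal r Hr). simpl. intros p q Hp _.
  apply Rabs_def2 in Hp. unfold pos_r. lra.
Qed.

(** * The squared gradient and the Bochner identity *)

Definition grad_sq (f v : R -> R -> R) (r th : R) : R :=
  d1 v r th ^ 2 + d2 v r th ^ 2 / f r th ^ 2.

(** The first derivative of [a ^ 2 + b ^ 2 / F ^ 2], with the derivatives of [a], [b], [F] as plain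
    numbers; [quot_dd] is the second. They serve both directions [r] and [th] and reduce Bochner's
    formula to an identity of rational functions. *)
Definition quot_d (a a1 b b1 F F1 : R) : R :=
  2 * a * a1 + 2 * b * b1 / F ^ 2 - 2 * b ^ 2 * F1 / F ^ 3.

Definition quot_dd (a a1 a2 b b1 b2 F F1 F2 : R) : R :=
  2 * a1 ^ 2 + 2 * a * a2 + 2 * (b1 ^ 2 + b * b2) / F ^ 2 - 8 * b * b1 * F1 / F ^ 3
  - 2 * b ^ 2 * F2 / F ^ 3 + 6 * b ^ 2 * F1 ^ 2 / F ^ 4.

(* [auto_derive] leaves derivatives of eta-expanded functions. *)
Ltac rewrite_derive H :=
  match type of H with
  | is_derive ?g ?x ?l => rewrite (is_derive_unique (fun t : R => g t : R) x l H)
  end.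

Lemma is_derive_quot (a b F : R -> R) (x a1 b1 F1 : R) :
  F x <> 0 -> is_derive a x a1 -> is_derive b x b1 -> is_derive F x F1 ->
  is_derive (fun t => a t ^ 2 + b t ^ 2 / F t ^ 2) x (quot_d (a x) a1 (b x) b1 (F x) F1).
Proof.
  intros HF Ha Hb HF1.
  auto_derive.
  - repeat split; try (eexists; eassumption). apply Rmult_integral_contrapositive_currified; lra.
  - rewrite_derive Ha; rewrite_derive Hb; rewrite_derive HF1.
    unfold quot_d. field. exact HF.
Qed.

Lemma is_derive_quot_d (a a1 b b1 F F1 : R -> R) (x a2 b2 F2 : R) :
  F x <> 0 ->
  is_derive a x (a1 x) -> is_derive b x (b1 x) -> is_derive F x (F1 x) ->
  is_derive a1 x a2 -> is_derive b1 x b2 -> is_derive F1 x F2 ->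
  is_derive (fun t => quot_d (a t) (a1 t) (b t) (b1 t) (F t) (F1 t)) x
    (quot_dd (a x) (a1 x) a2 (b x) (b1 x) b2 (F x) (F1 x) F2).
Proof.
  intros HF Ha Hb Hf Ha1 Hb1 HF1. unfold quot_d.
  auto_derive.
  - repeat split; try (eexists; eassumption); repeat apply Rmult_integral_contrapositive_currified; lra.
  - rewrite_derive Ha; rewrite_derive Hb; rewrite_derive Hf; rewrite_derive Ha1; rewrite_derive Hb1; rewrite_derive HF1.
    unfold quot_dd. field. exact HF.
Qed.

(** Here [a] and [b] are [v_r] and [v_theta], and shared letters such as [rt] and [Frt] encode the
    symmetry of mixed derivatives. The equation solved for [rr], and its derivatives in [r] and
    [theta], eliminate [rr], [rrr] and [rrt]; the remaining variables are free. *)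
Lemma bochner_algebra (a b rr rt tt rrr rrt rtt ttt F Fr Ft Frr Frt Ftt : R) :
  F <> 0 ->
  rr = - (Fr / F) * a - tt / F ^ 2 + Ft * b / F ^ 3 ->
  rrr = - (Frr / F - Fr ^ 2 / F ^ 2) * a - Fr / F * rr - rtt / F ^ 2 + 2 * tt * Fr / F ^ 3
    + (Frt * b + Ft * rt) / F ^ 3 - 3 * Ft * b * Fr / F ^ 4 ->
  rrt = - (Frt / F - Fr * Ft / F ^ 2) * a - Fr / F * rt - ttt / F ^ 2 + 2 * tt * Ft / F ^ 3
    + (Ftt * b + Ft * tt) / F ^ 3 - 3 * Ft ^ 2 * b / F ^ 4 ->
  quot_dd a rr rrr b rt rrt F Fr Frr + Fr / F * quot_d a rr b rt F Fr
    + / F ^ 2 * quot_dd a rt rtt b tt ttt F Ft Ftt - Ft / F ^ 3 * quot_d a rt b tt F Ft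
  = 4 * ((rt / F - b * Fr / F ^ 2) ^ 2 + rr ^ 2) + 2 * (- Frr / F) * (a ^ 2 + b ^ 2 / F ^ 2).
Proof.
  intros HF Hrr Hrrr Hrrt. unfold quot_d, quot_dd. rewrite Hrrr, Hrrt, Hrr. field. exact HF.
Qed.

Lemma is_derive_solved_eq (a b tt F Fr Ft : R -> R) (x a' b' tt' F' Fr' Ft' : R) :
  F x <> 0 ->
  is_derive a x a' -> is_derive b x b' -> is_derive tt x tt' ->
  is_derive F x F' -> is_derive Fr x Fr' -> is_derive Ft x Ft' ->
  is_derive (fun t => - (Fr t / F t) * a t - tt t / F t ^ 2 + Ft t * b t / F t ^ 3) x
    (- (Fr' / F x - Fr x * F' / F x ^ 2) * a x - Fr x / F x * a' - tt' / F x ^ 2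
     + 2 * tt x * F' / F x ^ 3 + (Ft' * b x + Ft x * b') / F x ^ 3
     - 3 * Ft x * b x * F' / F x ^ 4).
Proof.
  intros HF Ha Hb Ht Hf Hr Hft.
  auto_derive.
  - repeat split; try (eexists; eassumption); repeat apply Rmult_integral_contrapositive_currified; lra.
  - rewrite_derive Ha; rewrite_derive Hb; rewrite_derive Ht; rewrite_derive Hf; rewrite_derive Hr; rewrite_derive Hft.
    field. exact HF.
Qed.

(** * Pointwise contradictions at an interior maximum *)

Lemma exp_le_compat x y : x <= y -> exp x <= exp y.
Proof. intros [Hlt | ->]; [left; apply exp_increasing, Hlt | lra]. Qed.

(** The last four conditions say that [G = phi ^ 2 * w + 4 * R0 ^ 2 * v ^ 2 + / r], with
    [phi = R0 ^ 2 - r ^ 2], has an interior maximum. Weighted by [1], [k = f' / f], [/ F ^ 2] and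
    [- Ft / F ^ 3] they add up to [Delta G <= 0], while Bochner's inequality forces
    [Delta G >= (2 - r * k) / r ^ 3 > 0]. As [phi] is radial, only the radial derivative of [w]
    enters the cross term. *)
Lemma bernstein_algebra (r R0 k w w1 w11 w2 w22 v vr vrr vt vtt F Ft a b P S : R) :
  1 < r < R0 -> 0 < F -> r * k <= 1 ->
  w = a ^ 2 + b ^ 2 -> w = vr ^ 2 + vt ^ 2 / F ^ 2 -> w1 = 2 * (b * P - a * S) ->
  4 * (P ^ 2 + S ^ 2) <= w11 + k * w1 + / F ^ 2 * w22 - Ft / F ^ 3 * w2 ->
  vrr + k * vr + / F ^ 2 * vtt - Ft / F ^ 3 * vt = 0 ->
  - 4 * r * (R0 ^ 2 - r ^ 2) * w + (R0 ^ 2 - r ^ 2) ^ 2 * w1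
    + 8 * R0 ^ 2 * v * vr - / r ^ 2 = 0 ->
  (R0 ^ 2 - r ^ 2) ^ 2 * w2 + 8 * R0 ^ 2 * v * vt = 0 ->
  (- 4 * (R0 ^ 2 - r ^ 2) + 8 * r ^ 2) * w - 8 * r * (R0 ^ 2 - r ^ 2) * w1
    + (R0 ^ 2 - r ^ 2) ^ 2 * w11 + 8 * R0 ^ 2 * (vr ^ 2 + v * vrr) + 2 / r ^ 3 <= 0 ->
  (R0 ^ 2 - r ^ 2) ^ 2 * w22 + 8 * R0 ^ 2 * (vt ^ 2 + v * vtt) <= 0 -> False.
Proof.
  intros Hr HF Hk Hw Hwv Hw1 HL Hlap G1 G2 G11 G22.
  set (phi := R0 ^ 2 - r ^ 2) in *.
  assert (Hphi : 0 < phi) by (unfold phi; nra).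
  set (L := w11 + k * w1 + / F ^ 2 * w22 - Ft / F ^ 3 * w2) in *.
  assert (HF2 : 0 < / F ^ 2) by (apply Rinv_0_lt_compat, pow_lt, HF).
  assert (Hr3 : 0 < / r ^ 3) by (apply Rinv_0_lt_compat, pow_lt; lra).
  assert (HG : phi ^ 2 * L + w * (- 4 * phi + 8 * r ^ 2 - 4 * (r * k) * phi) - 8 * r * phi * w1
    + 8 * R0 ^ 2 * w + (2 - r * k) * / r ^ 3 <= 0).
  { assert (E : phi ^ 2 * L + w * (- 4 * phi + 8 * r ^ 2 - 4 * (r * k) * phi) - 8 * r * phi * w1
      + 8 * R0 ^ 2 * w + (2 - r * k) * / r ^ 3 =
      ((- 4 * phi + 8 * r ^ 2) * w - 8 * r * phi * w1
        + phi ^ 2 * w11 + 8 * R0 ^ 2 * (vr ^ 2 + v * vrr) + 2 / r ^ 3)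
      + k * (- 4 * r * phi * w + phi ^ 2 * w1 + 8 * R0 ^ 2 * v * vr - / r ^ 2)
      + / F ^ 2 * (phi ^ 2 * w22 + 8 * R0 ^ 2 * (vt ^ 2 + v * vtt))
      - Ft / F ^ 3 * (phi ^ 2 * w2 + 8 * R0 ^ 2 * v * vt)
      - 8 * R0 ^ 2 * v * (vrr + k * vr + / F ^ 2 * vtt - Ft / F ^ 3 * vt)
      + 8 * R0 ^ 2 * (w - (vr ^ 2 + vt ^ 2 / F ^ 2))).
    { unfold L. field. split; lra. }
    rewrite E, G1, G2, Hlap, <- Hwv.
    assert (/ F ^ 2 * (phi ^ 2 * w22 + 8 * R0 ^ 2 * (vt ^ 2 + v * vtt)) <= 0) by nra.
    lra. }
  assert (Hsq : 0 <= (phi * P - 2 * r * b) ^ 2 + (phi * S + 2 * r * a) ^ 2)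
    by (apply Rplus_le_le_0_compat; apply pow2_ge_0).
  assert (HL2 : phi ^ 2 * (4 * (P ^ 2 + S ^ 2)) <= phi ^ 2 * L)
    by (apply Rmult_le_compat_l; [apply pow2_ge_0 | exact HL]).
  assert (Hw0 : 0 <= w) by (rewrite Hw; generalize (pow2_ge_0 a) (pow2_ge_0 b); lra).
  assert (Hkw : 0 <= w * phi * (1 - r * k)) by (repeat apply Rmult_le_pos; lra).
  assert (Hpos : 0 < (2 - r * k) * / r ^ 3) by (apply Rmult_lt_0_compat; lra).
  (* Completing the square absorbs the cross term of [phi ^ 2] and [w] into the Hessian term at the
     cost of [16 * r ^ 2 * w]. *)
  assert (E1 : phi ^ 2 * (4 * (P ^ 2 + S ^ 2)) - 8 * r * phi * w1 + 16 * r ^ 2 * w =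
    4 * ((phi * P - 2 * r * b) ^ 2 + (phi * S + 2 * r * a) ^ 2)) by (rewrite Hw1, Hw; ring).
  (* The coefficient [4 * R0 ^ 2] of [v ^ 2] is chosen for this line: its contribution
     [8 * R0 ^ 2 * w] turns the deficit [- 8 * r ^ 2 * w] into [8 * phi * w]. *)
  assert (E2 : w * (- 4 * phi + 8 * r ^ 2 - 4 * (r * k) * phi) + 8 * R0 ^ 2 * w - 16 * r ^ 2 * w
    = 4 * (w * phi * (1 - r * k))) by (unfold phi; ring).
  lra.
Qed.

(** With [l] the logarithmic derivative of [growth_weight], the maximum conditions give
    [w1 = - l * w] and an upper bound for the Laplacian of [w]. Against Bochner's inequality the
    terms in [l ^ 2] cancel, leaving [l' + k * l <= 0], whose left side is the Laplacian of the
    logarithm of the weight and is positive. *)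
Lemma growth_algebra (r delta k w w1 w11 w2 w22 F Ft a b P S : R) :
  1 < r -> 0 <= delta -> 0 < F -> r * k <= 1 -> 0 < w ->
  w = a ^ 2 + b ^ 2 -> w1 = 2 * (b * P - a * S) ->
  4 * (P ^ 2 + S ^ 2) <= w11 + k * w1 + / F ^ 2 * w22 - Ft / F ^ 3 * w2 ->
  w1 + (- (2 * delta / r) - 2 / r ^ 2) * w = 0 -> w2 = 0 ->
  w11 + 2 * (- (2 * delta / r) - 2 / r ^ 2) * w1
    + (2 * delta / r ^ 2 + 4 / r ^ 3 + (- (2 * delta / r) - 2 / r ^ 2) ^ 2) * w <= 0 ->
  w22 <= 0 -> False.
Proof.
  intros Hr Hd HF Hk Hw0 Hw Hw1 HL Q1 Q2 Q11 Q22.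
  set (l := - (2 * delta / r) - 2 / r ^ 2) in *.
  assert (HF2 : 0 < / F ^ 2) by (apply Rinv_0_lt_compat, pow_lt, HF).
  assert (Hr2 : 0 < / r ^ 2) by (apply Rinv_0_lt_compat, pow_lt; lra).
  assert (Hr3 : 0 < / r ^ 3) by (apply Rinv_0_lt_compat, pow_lt; lra).
  assert (Hw1' : w1 = - l * w) by lra.
  (* Cauchy-Schwarz; the defect is [4 * (a * P + b * S) ^ 2]. *)
  assert (Hcs : w1 ^ 2 <= w * (4 * (P ^ 2 + S ^ 2))).
  { rewrite Hw1, Hw. generalize (pow2_ge_0 (a * P + b * S)). nra. }
  assert (H22 : / F ^ 2 * w22 <= 0) by nra.
  assert (Hup : 4 * (P ^ 2 + S ^ 2) <= w * (l ^ 2 - (2 * delta / r ^ 2 + 4 / r ^ 3) - k * l)).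
  { rewrite Q2, Hw1' in HL. rewrite Hw1' in Q11. nra. }
  assert (Hl : w ^ 2 * l ^ 2 <= w * (w * (l ^ 2 - (2 * delta / r ^ 2 + 4 / r ^ 3) - k * l))).
  { apply Rle_trans with (w * (4 * (P ^ 2 + S ^ 2))).
    - replace (w ^ 2 * l ^ 2) with (w1 ^ 2) by (rewrite Hw1'; ring). exact Hcs.
    - apply Rmult_le_compat_l; lra. }
  assert (E : (2 * delta / r ^ 2 + 4 / r ^ 3) + k * l =
    2 * / r ^ 3 + 2 * (1 - r * k) * (delta * / r ^ 2 + / r ^ 3)) by (unfold l; field; lra).
  assert (0 <= (1 - r * k) * (delta * / r ^ 2 + / r ^ 3)) by (apply Rmult_le_pos; nra).
  assert (Hneg : 0 < (2 * delta / r ^ 2 + 4 / r ^ 3) + k * l) by lra.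
  assert (0 < w ^ 2 * ((2 * delta / r ^ 2 + 4 / r ^ 3) + k * l)) by (apply Rmult_lt_0_compat; [apply pow_lt |]; assumption).
  lra.
Qed.

(** * Derivatives of the two test functions *)

Lemma is_derive_bernstein (w v : R -> R) (r w' v' R0 : R) :
  r <> 0 -> is_derive w r w' -> is_derive v r v' ->
  is_derive (fun r => (R0 ^ 2 - r ^ 2) ^ 2 * w r + 4 * R0 ^ 2 * v r ^ 2 + / r) r
    (- 4 * r * (R0 ^ 2 - r ^ 2) * w r + (R0 ^ 2 - r ^ 2) ^ 2 * w'
      + 8 * R0 ^ 2 * v r * v' - / r ^ 2).
Proof.
  intros Hr Hw Hv. auto_derive.
  - repeat split; try (eexists; eassumption); assumption.
  - rewrite_derive Hw; rewrite_derive Hv. field. exact Hr.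
Qed.

Lemma is_derive_bernstein_d (w w1 v v1 : R -> R) (r w2 v2 R0 : R) :
  r <> 0 -> is_derive w r (w1 r) -> is_derive v r (v1 r) ->
  is_derive w1 r w2 -> is_derive v1 r v2 ->
  is_derive (fun r => - 4 * r * (R0 ^ 2 - r ^ 2) * w r + (R0 ^ 2 - r ^ 2) ^ 2 * w1 r
      + 8 * R0 ^ 2 * v r * v1 r - / r ^ 2) r
    ((- 4 * (R0 ^ 2 - r ^ 2) + 8 * r ^ 2) * w r - 8 * r * (R0 ^ 2 - r ^ 2) * w1 r
      + (R0 ^ 2 - r ^ 2) ^ 2 * w2 + 8 * R0 ^ 2 * (v1 r ^ 2 + v r * v2) + 2 / r ^ 3).
Proof.
  intros Hr Hw Hv Hw1 Hv1. auto_derive.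
  - repeat split; try (eexists; eassumption). apply (pow_nonzero r 2 Hr).
  - rewrite_derive Hw; rewrite_derive Hv; rewrite_derive Hw1; rewrite_derive Hv1. field. exact Hr.
Qed.

Lemma is_derive_affine_sq (w v : R -> R) (t w' v' A B C : R) :
  is_derive w t w' -> is_derive v t v' ->
  is_derive (fun t => A * w t + 4 * B * v t ^ 2 + C) t (A * w' + 8 * B * v t * v').
Proof.
  intros Hw Hv. auto_derive.
  - repeat split; try (eexists; eassumption).
  - rewrite_derive Hw; rewrite_derive Hv. ring.
Qed.

Lemma is_derive_affine_prod (w v v1 : R -> R) (t w' v2 A B : R) :
  is_derive w t w' -> is_derive v t (v1 t) -> is_derive v1 t v2 ->
  is_derive (fun t => A * w t + 8 * B * v t * v1 t) t (A * w' + 8 * B * (v1 t ^ 2 + v t * v2)).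
Proof.
  intros Hw Hv Hv1. auto_derive.
  - repeat split; try (eexists; eassumption).
  - rewrite_derive Hw; rewrite_derive Hv; rewrite_derive Hv1. ring.
Qed.

(** This is [r^(- 2 delta) * exp (2 / r)]. The second factor supplies strictness, even for
    [delta = 0], and stays between [1] and [exp 2] for [r >= 1], so it costs only a constant. *)
Definition growth_weight (delta r : R) : R := exp (- (2 * delta * ln r) + 2 / r).

Lemma is_derive_growth (w : R -> R) (r w' delta : R) :
  0 < r -> is_derive w r w' ->
  is_derive (fun r => growth_weight delta r * w r) r
    (growth_weight delta r * (w' + (- (2 * delta / r) - 2 / r ^ 2) * w r)).
Proof.
  intros Hr Hw. unfold growth_weight. auto_derive.
  - repeat split; try (eexists; eassumption); lra.
  - rewrite_derive Hw. unfold Rdiv. set (E := exp _). field. lra.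
Qed.

Lemma is_derive_growth_d (w w1 : R -> R) (r w2 delta : R) :
  0 < r -> is_derive w r (w1 r) -> is_derive w1 r w2 ->
  is_derive (fun r => growth_weight delta r * (w1 r + (- (2 * delta / r) - 2 / r ^ 2) * w r)) r
    (growth_weight delta r * (w2 + 2 * (- (2 * delta / r) - 2 / r ^ 2) * w1 r
      + (2 * delta / r ^ 2 + 4 / r ^ 3 + (- (2 * delta / r) - 2 / r ^ 2) ^ 2) * w r)).
Proof.
  intros Hr Hw Hw1. unfold growth_weight. auto_derive.
  - repeat split; try (eexists; eassumption); try lra. apply (pow_nonzero r 2); lra.
  - rewrite_derive Hw; rewrite_derive Hw1. unfold Rdiv. set (E := exp _). field. lra.
Qed.

(** * Gradient estimates for a harmonic function in polar coordinates *)

(** Bochner's formula differentiates the equation once, hence three derivatives of [v] and two of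
    [f]. Periodicity of [v] and its first derivatives makes the test functions periodic in the
    angle. *)
Record harmonic_polar (f v : R -> R -> R) : Prop := {
  hp_f_C2 : CkOn 2 pos_r f;
  hp_f_pos : forall r th, 0 < r -> 0 < f r th;
  hp_f_per : forall r, 0 < r -> periodic2 (f r);
  hp_concave : forall r th, 0 < r -> d1 (d1 f) r th <= 0;
  hp_v_C3 : CkOn 3 whole_plane v;
  hp_v_per : forall r, periodic2 (v r);
  hp_d1v_per : forall r, periodic2 (d1 v r);
  hp_d2v_per : forall r, periodic2 (d2 v r);
  hp_lap : forall r th, 0 < r -> lap_g f v r th = 0 }.

Definition gs1 (f v : R -> R -> R) (r th : R) : R :=
  quot_d (d1 v r th) (d1 (d1 v) r th) (d2 v r th) (d1 (d2 v) r th) (f r th) (d1 f r th).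
Definition gs2 (f v : R -> R -> R) (r th : R) : R :=
  quot_d (d1 v r th) (d2 (d1 v) r th) (d2 v r th) (d2 (d2 v) r th) (f r th) (d2 f r th).
Definition gs11 (f v : R -> R -> R) (r th : R) : R :=
  quot_dd (d1 v r th) (d1 (d1 v) r th) (d1 (d1 (d1 v)) r th)
    (d2 v r th) (d1 (d2 v) r th) (d1 (d1 (d2 v)) r th)
    (f r th) (d1 f r th) (d1 (d1 f) r th).
Definition gs22 (f v : R -> R -> R) (r th : R) : R :=
  quot_dd (d1 v r th) (d2 (d1 v) r th) (d2 (d2 (d1 v)) r th)
    (d2 v r th) (d2 (d2 v) r th) (d2 (d2 (d2 v)) r th)
    (f r th) (d2 f r th) (d2 (d2 f) r th).

(* The tangent line at [r] lies above the positive graph, so it is nonnegative at [0]. *)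
Lemma concave_slope (g g1 g2 : R -> R) (r : R) :
  0 < r ->
  (forall t, 0 < t -> is_derive g t (g1 t)) ->
  (forall t, 0 < t -> is_derive g1 t (g2 t)) ->
  (forall t, 0 < t -> g2 t <= 0) -> (forall t, 0 < t -> 0 < g t) ->
  r * g1 r <= g r.
Proof.
  intros Hr Hg Hg1 Hg2 Hpos.
  assert (Htan : forall e, 0 < e < r -> g1 r * (r - e) < g r).
  { intros e He.
    destruct (MVT_cor2 g g1 e r) as [c [Hc1 Hc2]]; [lra | |].
    { intros t Ht. apply is_derive_Reals, Hg. lra. }
    destruct (MVT_cor2 g1 g2 c r) as [c' [Hc1' Hc2']]; [lra | |].
    { intros t Ht. apply is_derive_Reals, Hg1. lra. }
    assert (H1 := Hg2 c' ltac:(lra)). assert (H2 := Hpos e ltac:(lra)).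
    assert (g1 r <= g1 c) by nra. nra. }
  destruct (Rle_lt_dec (r * g1 r) (g r)) as [|Hlt]; [assumption |]. exfalso.
  assert (Hgr := Hpos r Hr).
  assert (Hg1r : 0 < g1 r) by nra.
  (* The tangent at [r] vanishes at [r - g r / g1 r], which is positive here; [e] is half of that,
     where the tangent is already negative. *)
  set (e := (r - g r / g1 r) / 2).
  assert (Hq : g r / g1 r < r).
  { apply (Rmult_lt_reg_r (g1 r)); [assumption |].
    replace (g r / g1 r * g1 r) with (g r) by (field; lra). lra. }
  assert (0 < g r / g1 r) by (apply Rdiv_lt_0_compat; assumption).
  assert (Hc := Htan e ltac:(unfold e; lra)).
  assert (Heq : g1 r * (r - e) = (r * g1 r + g r) / 2) by (unfold e; field; lra).
  lra.
Qed.

Section HarmonicPolar.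
Context {f v : R -> R -> R} (H : harmonic_polar f v).

(** The Laplacian of the distance [r] is [f' / f], so this is the comparison with the flat value
    [1 / r]. *)
Lemma slope_le r th : 0 < r -> r * (d1 f r th / f r th) <= 1.
Proof.
  intros Hr.
  assert (Hf := hp_f_pos f v H r th Hr).
  assert (Hs : r * d1 f r th <= f r th).
  { apply (concave_slope (fun t => f t th) (fun t => d1 f t th) (fun t => d1 (d1 f) t th)); auto.
    - intros t Ht. eapply CkOn_is_derive1; [apply H | exact Ht].
    - intros t Ht. eapply CkOn_is_derive1; [apply (hp_f_C2 f v H) | exact Ht].
    - intros t Ht. apply (hp_concave f v H t th Ht).
    - intros t Ht. apply (hp_f_pos f v H t th Ht). }
  apply (Rmult_le_reg_r (f r th)); [assumption |].
  replace (r * (d1 f r th / f r th) * f r th) with (r * d1 f r th) by (field; lra). lra.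
Qed.

Let Hv1 : CkOn 2 whole_plane (d1 v) := proj1 (proj2 (hp_v_C3 f v H)).
Let Hv2 : CkOn 2 whole_plane (d2 v) := proj2 (proj2 (hp_v_C3 f v H)).
Let Hv11 : CkOn 1 whole_plane (d1 (d1 v)) := proj1 (proj2 Hv1).
Let Hv12 : CkOn 1 whole_plane (d2 (d1 v)) := proj2 (proj2 Hv1).
Let Hv21 : CkOn 1 whole_plane (d1 (d2 v)) := proj1 (proj2 Hv2).
Let Hv22 : CkOn 1 whole_plane (d2 (d2 v)) := proj2 (proj2 Hv2).
Let Hf1 : CkOn 1 pos_r (d1 f) := proj1 (proj2 (hp_f_C2 f v H)).
Let Hf2 : CkOn 1 pos_r (d2 f) := proj2 (proj2 (hp_f_C2 f v H)).

Let f_neq0 r th : 0 < r -> f r th <> 0.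
Proof. intros Hr. generalize (hp_f_pos f v H r th Hr). lra. Qed.

Ltac der1 := eapply CkOn_is_derive1; [eassumption || apply H | assumption || exact I].
Ltac der2 := eapply CkOn_is_derive2; [eassumption || apply H | assumption || exact I].

Lemma is_derive_gs_1 r th : 0 < r ->
  is_derive (fun t => grad_sq f v t th) r (gs1 f v r th).
Proof.
  intros Hr.
  apply (is_derive_quot (fun t => d1 v t th) (fun t => d2 v t th) (fun t => f t th));
    [auto | der1 | der1 | der1].
Qed.

Lemma is_derive_gs_2 r th : 0 < r ->
  is_derive (fun t => grad_sq f v r t) th (gs2 f v r th).
Proof.
  intros Hr.
  apply (is_derive_quot (fun t => d1 v r t) (fun t => d2 v r t) (fun t => f r t));
    [auto | der2 | der2 | der2].
Qed.

Lemma is_derive_gs_11 r th : 0 < r ->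
  is_derive (fun t => gs1 f v t th) r (gs11 f v r th).
Proof.
  intros Hr.
  apply (is_derive_quot_d (fun t => d1 v t th) (fun t => d1 (d1 v) t th) (fun t => d2 v t th)
    (fun t => d1 (d2 v) t th) (fun t => f t th) (fun t => d1 f t th));
    [auto | der1 | der1 | der1 | der1 | der1 | der1].
Qed.

Lemma is_derive_gs_22 r th : 0 < r ->
  is_derive (fun t => gs2 f v r t) th (gs22 f v r th).
Proof.
  intros Hr.
  apply (is_derive_quot_d (fun t => d1 v r t) (fun t => d2 (d1 v) r t) (fun t => d2 v r t)
    (fun t => d2 (d2 v) r t) (fun t => f r t) (fun t => d2 f r t));
    [auto | der2 | der2 | der2 | der2 | der2 | der2].
Qed.

Lemma mixed_derivatives k h : CkOn (S (S k)) whole_plane h -> d1 (d2 h) = d2 (d1 h).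
Proof.
  intros Hh. extensionality x; extensionality y.
  apply (CkOn_Schwarz k whole_plane); [apply locally_2d_forall; intros; exact I | exact Hh].
Qed.

Lemma harmonic_solved r th : 0 < r ->
  d1 (d1 v) r th = - (d1 f r th / f r th) * d1 v r th - d2 (d2 v) r th / f r th ^ 2
    + d2 f r th * d2 v r th / f r th ^ 3.
Proof.
  intros Hr. generalize (hp_lap f v H r th Hr) (f_neq0 r th Hr). unfold lap_g.
  intros E Hn.
  replace (d1 (d1 v) r th) with (d1 (d1 v) r th - 0) by ring. rewrite <- E. field. exact Hn.
Qed.

Lemma gradient_bochner r th : 0 < r ->
  gs11 f v r th + d1 f r th / f r th * gs1 f v r th
    + / f r th ^ 2 * gs22 f v r th - d2 f r th / f r th ^ 3 * gs2 f v r th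
  = 4 * ((d1 (d2 v) r th / f r th - d2 v r th * d1 f r th / f r th ^ 2) ^ 2 + d1 (d1 v) r th ^ 2)
    + 2 * gauss_curv f r th * grad_sq f v r th.
Proof.
  intros Hr. unfold gs11, gs1, gs22, gs2, gauss_curv, grad_sq.
  assert (E0 : d1 (d2 v) = d2 (d1 v)) by (apply (mixed_derivatives 1), H).
  assert (E1 : d1 (d2 (d1 v)) = d2 (d1 (d1 v))) by (apply (mixed_derivatives 0), Hv1).
  assert (E2 : d1 (d2 (d2 v)) = d2 (d1 (d2 v))) by (apply (mixed_derivatives 0), Hv2).
  assert (Ef : d1 (d2 f) r th = d2 (d1 f) r th)
    by (apply (CkOn_Schwarz 0 pos_r); [apply pos_r_open; exact Hr | apply H]).
  rewrite E0 in E2. rewrite E0, E1.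
  apply bochner_algebra with (Frt := d2 (d1 f) r th).
  - auto.
  - apply harmonic_solved, Hr.
  - rewrite <- E2, <- Ef.
    (* The third derivatives come from differentiating the solved equation. It holds only for
       [r > 0], so in the [r] direction only a local equality is available; in the angle the
       equality is global. *)
    transitivity (d1 (fun r th => - (d1 f r th / f r th) * d1 v r th - d2 (d2 v) r th / f r th ^ 2
      + d2 f r th * d2 v r th / f r th ^ 3) r th).
    + apply Derive_ext_loc.
      generalize (locally_2d_1d_const_y pos_r r th (pos_r_open r th Hr)).
      apply filter_imp. intros t Ht. apply harmonic_solved, Ht.
    + apply is_derive_unique. rewrite <- E0.
      evar_last.
      * apply (is_derive_solved_eq (fun t => d1 v t th) (fun t => d2 v t th)
          (fun t => d2 (d2 v) t th) (fun t => f t th) (fun t => d1 f t th) (fun t => d2 f t th));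
          [auto | der1 | der1 | der1 | der1 | der1 | der1].
      * simpl. field. auto.
  - transitivity (d2 (fun r th => - (d1 f r th / f r th) * d1 v r th - d2 (d2 v) r th / f r th ^ 2
      + d2 f r th * d2 v r th / f r th ^ 3) r th).
    + apply Derive_ext. intros t. apply harmonic_solved, Hr.
    + apply is_derive_unique.
      evar_last.
      * apply (is_derive_solved_eq (fun t => d1 v r t) (fun t => d2 v r t)
          (fun t => d2 (d2 v) r t) (fun t => f r t) (fun t => d1 f r t) (fun t => d2 f r t));
          [auto | der2 | der2 | der2 | der2 | der2 | der2].
      * simpl. field. auto.
Qed.

(* In the frame [dr, f^-1 dtheta] the gradient of [v] is [(a, b)] and [P], [S] are the
   components of its covariant derivative. *)
Lemma gradient_bochner_ineq r th : 0 < r ->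
  exists a b P S : R, grad_sq f v r th = a ^ 2 + b ^ 2 /\
    gs1 f v r th = 2 * (b * P - a * S) /\
    4 * (P ^ 2 + S ^ 2) <=
      gs11 f v r th + d1 f r th / f r th * gs1 f v r th
      + / f r th ^ 2 * gs22 f v r th - d2 f r th / f r th ^ 3 * gs2 f v r th.
Proof.
  intros Hr. assert (Hn := f_neq0 r th Hr). assert (Hp := hp_f_pos f v H r th Hr).
  (* The Hessian of a harmonic function is trace-free, so its angular diagonal entry [S] is
     [- v_rr]. *)
  exists (d1 v r th), (d2 v r th / f r th),
    (d1 (d2 v) r th / f r th - d2 v r th * d1 f r th / f r th ^ 2), (- d1 (d1 v) r th).
  assert (Hw : grad_sq f v r th = d1 v r th ^ 2 + (d2 v r th / f r th) ^ 2)
    by (unfold grad_sq; field; exact Hn).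
  split; [exact Hw |]. split; [unfold gs1, quot_d; field; exact Hn |].
  rewrite gradient_bochner by exact Hr.
  assert (HK : 0 <= gauss_curv f r th).
  { unfold gauss_curv. apply Rmult_le_pos.
    - generalize (hp_concave f v H r th Hr). lra.
    - left. apply Rinv_0_lt_compat, Hp. }
  rewrite Hw.
  assert (0 <= gauss_curv f r th * (d1 v r th ^ 2 + (d2 v r th / f r th) ^ 2)).
  { apply Rmult_le_pos; [exact HK |]. generalize (pow2_ge_0 (d1 v r th)) (pow2_ge_0 (d2 v r th / f r th)). lra. }
  nra.
Qed.

Lemma jcont_grad_sq r th : 0 < r -> jcont (grad_sq f v) r th.
Proof.
  intros Hr. apply jcont_plus.
  - apply jcont_sqr. eapply CkOn_jcont; [exact Hv1 | exact I].
  - apply (jcont_mult (fun r th => d2 v r th ^ 2) (fun r th => / f r th ^ 2)).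
    + apply jcont_sqr. eapply CkOn_jcont; [exact Hv2 | exact I].
    + apply (jcont_inv (fun r th => f r th ^ 2)); [apply pow_nonzero; auto |].
      apply jcont_sqr. eapply CkOn_jcont; [apply H | exact Hr].
Qed.

Lemma periodic_grad_sq r : 0 < r -> periodic2 (grad_sq f v r).
Proof.
  intros Hr th. unfold grad_sq.
  rewrite (hp_d1v_per f v H), (hp_d2v_per f v H), (hp_f_per f v H) by exact Hr. reflexivity.
Qed.

Lemma grad_sq_ge0 r th : 0 < r -> 0 <= grad_sq f v r th.
Proof.
  intros Hr. destruct (gradient_bochner_ineq r th Hr) as (a & b & _ & _ & -> & _).
  generalize (pow2_ge_0 a) (pow2_ge_0 b). lra.
Qed.

Lemma jcont_v r th : jcont v r th.
Proof. eapply CkOn_jcont; [apply H | exact I]. Qed.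

(* Bernstein's trick: [(R^2 - r^2)^2 |grad v|^2 + 4 R^2 v^2] is subharmonic, and adding
   [1 / r] makes it strictly so because [f' / f <= 1 / r]. *)
Lemma bernstein_bound (R0 B : R) :
  1 < R0 ->
  (forall th, (R0 ^ 2 - 1) ^ 2 * grad_sq f v 1 th + 4 * R0 ^ 2 * v 1 th ^ 2 + 1 <= B) ->
  (forall th, 4 * R0 ^ 2 * v R0 th ^ 2 + 1 <= B) ->
  forall r th, 1 <= r <= R0 -> (R0 ^ 2 - r ^ 2) ^ 2 * grad_sq f v r th <= B.
Proof.
  intros HR B1 B2 r th Hr.
  set (w := grad_sq f v).
  set (G := fun r th => (R0 ^ 2 - r ^ 2) ^ 2 * w r th + 4 * R0 ^ 2 * v r th ^ 2 + / r).
  assert (HG : G r th <= B).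
  { apply (annulus_max_principle G
      (fun r th => - 4 * r * (R0 ^ 2 - r ^ 2) * w r th + (R0 ^ 2 - r ^ 2) ^ 2 * gs1 f v r th
        + 8 * R0 ^ 2 * v r th * d1 v r th - / r ^ 2)
      (fun r th => (- 4 * (R0 ^ 2 - r ^ 2) + 8 * r ^ 2) * w r th
        - 8 * r * (R0 ^ 2 - r ^ 2) * gs1 f v r th + (R0 ^ 2 - r ^ 2) ^ 2 * gs11 f v r th
        + 8 * R0 ^ 2 * (d1 v r th ^ 2 + v r th * d1 (d1 v) r th) + 2 / r ^ 3)
      (fun r th => (R0 ^ 2 - r ^ 2) ^ 2 * gs2 f v r th + 8 * R0 ^ 2 * v r th * d2 v r th)
      (fun r th => (R0 ^ 2 - r ^ 2) ^ 2 * gs22 f v r th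
        + 8 * R0 ^ 2 * (d2 v r th ^ 2 + v r th * d2 (d2 v) r th)) 1 R0 B); try lra.
    - clear r th Hr; intros r th Hr. unfold G. apply jcont_plus; [apply jcont_plus |].
      + apply (jcont_mult (fun r _ => (R0 ^ 2 - r ^ 2) ^ 2)).
        * apply (jcont_fst (fun r => (R0 ^ 2 - r ^ 2) ^ 2)).
          apply (ex_derive_continuous (V := R_NormedModule)). auto_derive; exact I.
        * apply jcont_grad_sq. lra.
      + apply (jcont_mult (fun _ _ => 4 * R0 ^ 2)); [apply continuous_const |].
        apply jcont_sqr, jcont_v.
      + apply (jcont_fst (fun r => / r)).
        apply (ex_derive_continuous (V := R_NormedModule)). auto_derive. lra.
    - intros s Hs t. unfold G, w. rewrite periodic_grad_sq, (hp_v_per f v H) by lra. reflexivity.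
    - intros s t Hs. unfold G.
      assert (Dw := is_derive_gs_1 s t ltac:(lra)). fold w in Dw.
      assert (Dv : is_derive (fun x => v x t) s (d1 v s t)) by der1.
      apply (is_derive_bernstein (fun x => w x t) (fun x => v x t) s _ _ R0); auto; lra.
    - intros s t Hs.
      apply (is_derive_bernstein_d (fun x => w x t) (fun x => gs1 f v x t)
        (fun x => v x t) (fun x => d1 v x t)); try lra.
      + apply is_derive_gs_1; lra.
      + der1.
      + apply is_derive_gs_11; lra.
      + der1.
    - intros s t Hs.
      apply (is_derive_affine_sq (fun x => w s x) (fun x => v s x)).
      + apply is_derive_gs_2; lra.
      + der2.
    - intros s t Hs.
      apply (is_derive_affine_prod (fun x => gs2 f v s x) (fun x => v s x) (fun x => d2 v s x)
        t (gs22 f v s t) (d2 (d2 v) s t)).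
      + apply is_derive_gs_22; lra.
      + der2.
      + der2.
    - intros t. unfold G. rewrite Rinv_1. generalize (B1 t). fold w. simpl; lra.
    (* The cutoff vanishes on the outer circle, so the gradient there does not enter. *)
    - intros t. unfold G. generalize (B2 t).
      assert (/ R0 <= 1) by (rewrite <- Rinv_1; apply Rinv_le_contravar; lra).
      replace (R0 ^ 2 - R0 ^ 2) with 0 by ring. simpl; lra.
    - clear r th Hr; intros r th Hr _ G1 G2 G11 G22.
      assert (Hp := hp_f_pos f v H r th ltac:(lra)).
      destruct (gradient_bochner_ineq r th ltac:(lra)) as (a & b & P & S & Hw & Hw1 & HL).
      apply (bernstein_algebra r R0 (d1 f r th / f r th) (w r th) (gs1 f v r th) (gs11 f v r th)
        (gs2 f v r th) (gs22 f v r th) (v r th) (d1 v r th) (d1 (d1 v) r th) (d2 v r th)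
        (d2 (d2 v) r th) (f r th) (d2 f r th) a b P S); auto.
      + apply slope_le; lra.
      + exact (hp_lap f v H r th ltac:(lra)). }
  unfold G in HG.
  assert (0 < / r) by (apply Rinv_0_lt_compat; lra).
  generalize (pow2_ge_0 (R0 * v r th)). fold w. nra.
Qed.

Lemma growth_weight_pos delta r : 0 < growth_weight delta r.
Proof. apply exp_pos. Qed.

(* [log |grad v|^2] is subharmonic and [2 delta log r - 2 / r] strictly superharmonic,
   so their difference has no interior maximum. *)
Lemma gradient_growth_bound (R0 delta B : R) :
  1 <= R0 -> 0 <= delta -> 0 <= B ->
  (forall th, grad_sq f v 1 th <= B) ->
  (forall th, grad_sq f v R0 th <= B * exp (2 * delta * ln R0)) ->
  forall r th, 1 <= r <= R0 -> grad_sq f v r th <= exp 2 * B * exp (2 * delta * ln r).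
Proof.
  intros HR Hd HB B1 B2 r th Hr.
  set (w := grad_sq f v).
  assert (HQ : growth_weight delta r * w r th <= exp 2 * B).
  { apply (annulus_max_principle (fun r th => growth_weight delta r * w r th)
      (fun r th => growth_weight delta r *
        (gs1 f v r th + (- (2 * delta / r) - 2 / r ^ 2) * w r th))
      (fun r th => growth_weight delta r *
        (gs11 f v r th + 2 * (- (2 * delta / r) - 2 / r ^ 2) * gs1 f v r th
         + (2 * delta / r ^ 2 + 4 / r ^ 3 + (- (2 * delta / r) - 2 / r ^ 2) ^ 2) * w r th))
      (fun r th => growth_weight delta r * gs2 f v r th)
      (fun r th => growth_weight delta r * gs22 f v r th) 1 R0); try lra.
    - intros s t Hs. apply (jcont_mult (fun r _ => growth_weight delta r)).
      + apply jcont_fst, (ex_derive_continuous (V := R_NormedModule)).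
        unfold growth_weight. auto_derive. lra.
      + apply jcont_grad_sq; lra.
    - intros s Hs t. unfold w. rewrite periodic_grad_sq by lra. reflexivity.
    - intros s t Hs. apply (is_derive_growth (fun x => w x t)); [lra |].
      apply is_derive_gs_1; lra.
    - intros s t Hs.
      apply (is_derive_growth_d (fun x => w x t) (fun x => gs1 f v x t)); [lra | |].
      + apply is_derive_gs_1; lra.
      + apply is_derive_gs_11; lra.
    - intros s t Hs. apply is_derive_scal, is_derive_gs_2; lra.
    - intros s t Hs. apply is_derive_scal, is_derive_gs_22; lra.
    - intros t. unfold growth_weight. rewrite ln_1.
      replace (- (2 * delta * 0) + 2 / 1) with 2 by field.
      apply Rmult_le_compat_l; [left; apply exp_pos | apply B1].
    - intros t. unfold growth_weight. rewrite exp_plus, exp_Ropp.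
      assert (He : exp (2 / R0) <= exp 2).
      { assert (Hi : / R0 <= 1) by (rewrite <- Rinv_1; apply Rinv_le_contravar; lra).
        apply exp_le_compat. unfold Rdiv. lra. }
      assert (Hp := exp_pos (2 * delta * ln R0)).
      apply Rle_trans with (/ exp (2 * delta * ln R0) * exp (2 / R0) * (B * exp (2 * delta * ln R0))).
      + apply Rmult_le_compat_l; [| apply B2].
        left. apply Rmult_lt_0_compat; [apply Rinv_0_lt_compat, Hp | apply exp_pos].
      + replace (/ exp (2 * delta * ln R0) * exp (2 / R0) * (B * exp (2 * delta * ln R0)))
          with (exp (2 / R0) * B) by (field; lra).
        apply Rmult_le_compat_r; assumption.
    - intros s t Hs HBs Q1 Q2 Q11 Q22.
      assert (Hg := growth_weight_pos delta s).
      (* Exceeding the nonnegative bound forces [w > 0], so zeros of the gradient need no separate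
         case. *)
      assert (Hwpos : 0 < w s t).
      { assert (0 <= exp 2 * B) by (apply Rmult_le_pos; [left; apply exp_pos | exact HB]).
        apply (Rmult_lt_reg_l (growth_weight delta s)); [exact Hg | lra]. }
      assert (Hle0 : forall x, growth_weight delta s * x <= 0 -> x <= 0).
      { intros x Hx. apply (Rmult_le_reg_l (growth_weight delta s)); [exact Hg | lra]. }
      assert (Heq0 : forall x, growth_weight delta s * x = 0 -> x = 0).
      { intros x Hx. apply Rmult_integral in Hx. destruct Hx; lra. }
      destruct (gradient_bochner_ineq s t ltac:(lra)) as (a & b & P & S & Hw & Hw1 & HL).
      apply (growth_algebra s delta (d1 f s t / f s t) (w s t) (gs1 f v s t) (gs11 f v s t)
        (gs2 f v s t) (gs22 f v s t) (f s t) (d2 f s t) a b P S); auto; try lra.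
      + apply (hp_f_pos f v H); lra.
      + apply slope_le; lra. }
  assert (Hi : 0 < / r) by (apply Rinv_0_lt_compat; lra).
  assert (E : w r th = growth_weight delta r * w r th * exp (2 * delta * ln r) * exp (- (2 / r))).
  { unfold growth_weight. rewrite exp_plus, !exp_Ropp.
    assert (H1 := exp_pos (2 * delta * ln r)). assert (H2 := exp_pos (2 / r)). field. split; lra. }
  assert (He1 : exp (- (2 / r)) <= 1).
  { rewrite <- exp_0. left. apply exp_increasing. unfold Rdiv. lra. }
  assert (Hp := exp_pos (2 * delta * ln r)).
  assert (HQ0 : 0 <= growth_weight delta r * w r th)
    by (apply Rmult_le_pos; [left; apply growth_weight_pos | apply grad_sq_ge0; lra]).
  rewrite E.
  apply Rle_trans with (growth_weight delta r * w r th * exp (2 * delta * ln r) * 1).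
  - apply Rmult_le_compat_l; [| exact He1]. apply Rmult_le_pos; lra.
  - rewrite Rmult_1_r. apply Rmult_le_compat_r; lra.
Qed.

End HarmonicPolar.

(** * From the growth of [u] to a bounded gradient and linear growth *)

Lemma annulus_bounded (h : R -> R -> R) (a b : R) :
  (forall r th, a <= r <= b -> jcont h r th) ->
  (forall r, a <= r <= b -> periodic2 (h r)) ->
  exists B, 0 <= B /\ forall r th, a <= r <= b -> Rabs (h r th) <= B.
Proof.
  intros Hc Hp.
  destruct (rectangle_bounded h a b 0 (2 * PI)) as [B HB]; [auto |].
  exists (Rabs B). split; [apply Rabs_pos |]. intros r th Hr.
  destruct (periodic2_reduce (h r) th (Hp r Hr)) as (th' & Hth' & ->).
  apply Rle_trans with B; [apply HB; lra | apply Rle_abs].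
Qed.

(** [real] sends infinite values to 0, so finiteness of the supremum has to be proved first; it
    follows from compactness in the angle. *)
Lemma Mmax_ge (v : R -> R -> R) (r th : R) :
  (forall th, jcont v r th) -> periodic2 (v r) -> Rabs (v r th) <= Mmax v r.
Proof.
  intros Hc Hp.
  destruct (annulus_bounded v r r) as [B [_ HB]].
  { intros s t Hs. replace s with r by lra. apply Hc. }
  { intros s Hs. replace s with r by lra. exact Hp. }
  unfold Mmax.
  set (E := fun y => exists th, 0 <= th < 2 * PI /\ y = Rabs (v r th)).
  destruct (Lub_Rbar_correct E) as [Hub Hleast].
  destruct (periodic2_reduce (v r) th Hp) as (th' & Hth' & ->).
  assert (H1 : Rbar_le (Rabs (v r th')) (Lub_Rbar E)) by (apply Hub; exists th'; auto).
  assert (H2 : Rbar_le (Lub_Rbar E) B).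
  { apply Hleast. intros y (t & _ & ->). apply HB. lra. }
  destruct (Lub_Rbar E) as [l| |]; simpl in *; tauto.
Qed.

Lemma d1_polar h r th : CkOn 1 whole_plane h ->
  d1 (polar h) r th = cos th * polar (d1 h) r th + sin th * polar (d2 h) r th.
Proof. intros Hh. apply is_derive_unique, is_derive_polar1, Hh. Qed.

Lemma d2_polar h r th : CkOn 1 whole_plane h ->
  d2 (polar h) r th = r * (-1 * sin th) * polar (d1 h) r th + r * cos th * polar (d2 h) r th.
Proof. intros Hh. apply is_derive_unique, is_derive_polar2, Hh. Qed.

Lemma cos_period_2PI th : cos (th + 2 * PI) = cos th.
Proof. rewrite cos_plus, cos_2PI, sin_2PI. ring. Qed.

Lemma sin_period_2PI th : sin (th + 2 * PI) = sin th.
Proof. rewrite sin_plus, cos_2PI, sin_2PI. ring. Qed.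

Lemma periodic_polar h r : periodic2 (polar h r).
Proof. intros th. unfold polar. rewrite cos_period_2PI, sin_period_2PI. reflexivity. Qed.

Lemma harmonic_polar_intro (f u : R -> R -> R) :
  polar_metric_fun f ->
  (forall r th, 0 < r -> 0 <= gauss_curv f r th) ->
  SmoothOn whole_plane u ->
  (forall r th, 0 < r -> lap_g f (polar u) r th = 0) ->
  harmonic_polar f (polar u).
Proof.
  intros (Hf & Hpos & Hper & _ & _) HK Hu Hlap.
  split; auto.
  - intros r Hr th. apply Hper, Hr.
  - intros r th Hr. generalize (HK r th Hr) (Hpos r th Hr). unfold gauss_curv. intros H1 H2.
    assert (E : d1 (d1 f) r th = - (- d1 (d1 f) r th / f r th * f r th)) by (field; lra).
    assert (0 <= - d1 (d1 f) r th / f r th * f r th) by (apply Rmult_le_pos; lra).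
    lra.
  - apply CkOn_polar, Hu.
  - apply periodic_polar.
  - intros r th. rewrite !d1_polar by apply Hu.
    rewrite cos_period_2PI, sin_period_2PI, !periodic_polar. reflexivity.
  - intros r th. rewrite !d2_polar by apply Hu.
    rewrite cos_period_2PI, sin_period_2PI, !periodic_polar. reflexivity.
Qed.

(** At [R0 / 2] the squared cutoff equals [9 / 16 * R0 ^ 4]; dividing by it gives the factors
    [64 / 9] and [16 / 9], rounded up to 8 and 2. *)
Lemma gradient_bound_half_radius (f v : R -> R -> R) (N M1 M R0 : R) :
  harmonic_polar f v -> 2 <= R0 -> 0 <= N ->
  (forall th, grad_sq f v 1 th <= N) -> (forall th, Rabs (v 1 th) <= M1) ->
  (forall th, Rabs (v R0 th) <= M) ->
  forall th, grad_sq f v (R0 / 2) th <= 8 * (M / R0) ^ 2 + 2 * N + 8 * M1 ^ 2 + 2.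
Proof.
  intros H HR HN HN1 HM1 HM th.
  assert (Hsq : forall x y, Rabs x <= y -> x ^ 2 <= y ^ 2).
  { intros x y Hxy. rewrite <- (pow2_abs x). apply pow_incr. split; [apply Rabs_pos | exact Hxy]. }
  (* The sum of the bounds on the two boundary circles, so that one constant dominates both. *)
  set (B := R0 ^ 4 * N + 4 * R0 ^ 2 * M1 ^ 2 + 4 * R0 ^ 2 * M ^ 2 + 1).
  assert (HR2 : 4 <= R0 ^ 2) by nra.
  assert (Hw : (R0 ^ 2 - (R0 / 2) ^ 2) ^ 2 * grad_sq f v (R0 / 2) th <= B).
  { apply (bernstein_bound H); try lra.
    - intros t. unfold B.
      assert (H1 := Hsq _ _ (HM1 t)). assert (H2 := HN1 t).
      assert (Hc : (R0 ^ 2 - 1) ^ 2 <= R0 ^ 4) by nra.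
      assert ((R0 ^ 2 - 1) ^ 2 * grad_sq f v 1 t <= R0 ^ 4 * N).
      { apply Rmult_le_compat; auto; [apply pow2_ge_0 | apply (grad_sq_ge0 H); lra]. }
      assert (0 <= R0 ^ 2 * M ^ 2) by (apply Rmult_le_pos; apply pow2_ge_0).
      assert (R0 ^ 2 * v 1 t ^ 2 <= R0 ^ 2 * M1 ^ 2) by (apply Rmult_le_compat_l; [lra | exact H1]).
      lra.
    - intros t. unfold B.
      assert (H1 := Hsq _ _ (HM t)).
      assert (0 <= R0 ^ 4 * N) by (apply Rmult_le_pos; [nra | exact HN]).
      assert (0 <= R0 ^ 2 * M1 ^ 2) by (apply Rmult_le_pos; apply pow2_ge_0).
      assert (R0 ^ 2 * v R0 t ^ 2 <= R0 ^ 2 * M ^ 2) by (apply Rmult_le_compat_l; [lra | exact H1]).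
      lra. }
  assert (HR4 : 0 < R0 ^ 4) by (apply pow_lt; lra).
  apply (Rmult_le_reg_l (9 / 16 * R0 ^ 4)); [lra |].
  replace (9 / 16 * R0 ^ 4 * grad_sq f v (R0 / 2) th)
    with ((R0 ^ 2 - (R0 / 2) ^ 2) ^ 2 * grad_sq f v (R0 / 2) th) by field.
  apply Rle_trans with (1 := Hw). unfold B.
  replace (9 / 16 * R0 ^ 4 * (8 * (M / R0) ^ 2 + 2 * N + 8 * M1 ^ 2 + 2))
    with (9 / 2 * (R0 ^ 2 * M ^ 2) + 9 / 8 * (R0 ^ 4 * N) + 9 / 2 * (R0 ^ 4 * M1 ^ 2) + 9 / 8 * R0 ^ 4)
    by (field; lra).
  assert (0 <= R0 ^ 2 * M ^ 2) by (apply Rmult_le_pos; apply pow2_ge_0).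
  assert (0 <= R0 ^ 4 * N) by (apply Rmult_le_pos; lra).
  assert (R0 ^ 2 * M1 ^ 2 <= R0 ^ 4 * M1 ^ 2).
  { apply Rmult_le_compat_r; [apply pow2_ge_0 | nra]. }
  assert (0 <= R0 ^ 4 * M1 ^ 2) by (apply Rmult_le_pos; [lra | apply pow2_ge_0]).
  assert (16 <= R0 ^ 4) by nra.
  lra.
Qed.

Lemma gradient_bounded (f v : R -> R -> R) :
  harmonic_polar f v ->
  (forall delta, 0 < delta -> forall R0, exists r, R0 < r /\ Mmax v r / Rpower r (1 + delta) < 1) ->
  exists D, 0 <= D /\ forall r th, 1 <= r -> grad_sq f v r th <= D.
Proof.
  intros H Hgrow.
  destruct (annulus_bounded (grad_sq f v) 1 1) as (N & HN & HN1).
  { intros r th Hr. apply (jcont_grad_sq H). lra. }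
  { intros r Hr. apply (periodic_grad_sq H). lra. }
  destruct (annulus_bounded v 1 1) as (M1 & HM1 & HMv).
  { intros r th _. apply (jcont_v H). }
  { intros r _. apply (hp_v_per f v H). }
  (* The half-radius bound with [(M / R0) ^ 2] replaced by 4, the factor found in [Hsq] below; it
     depends neither on [delta] nor on the outer circle. *)
  set (B := 32 + 2 * N + 8 * M1 ^ 2 + 2).
  assert (HB : 0 <= B) by (unfold B; generalize (pow2_ge_0 M1); lra).
  (* The first [exp 2] comes from the weight in [gradient_growth_bound], the second bounds
     [r^(2 delta)]. *)
  exists (exp 2 * B * exp 2). split.
  { repeat apply Rmult_le_pos; auto; left; apply exp_pos. }
  intros r th Hr.
  assert (Hln : 0 <= ln r).
  { rewrite <- ln_1. destruct Hr as [Hr | <-]; [left; apply ln_increasing; lra | lra]. }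
  (* This choice makes [r ^ (2 delta)] bounded independently of [r]. *)
  set (delta := / (1 + ln r)).
  assert (Hd0 : 0 < delta) by (apply Rinv_0_lt_compat; lra).
  assert (Hd1 : delta <= 1) by (rewrite <- Rinv_1; apply Rinv_le_contravar; lra).
  assert (Hdl : delta * ln r <= 1).
  { apply (Rmult_le_reg_l (1 + ln r)); [lra |].
    unfold delta. rewrite <- Rmult_assoc, Rinv_r; lra. }
  (* Bernstein's estimate halves the radius, so [s > 2 * r] is needed to keep [r] inside the annulus
     up to [s / 2]. *)
  destruct (Hgrow delta Hd0 (2 * r)) as (s & Hs & HMs).
  assert (HNw : forall t, grad_sq f v 1 t <= N).
  { intros t. eapply Rle_trans; [apply Rle_abs | apply HN1; lra]. }
  apply Rle_trans with (exp 2 * B * exp (2 * delta * ln r)).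
  - apply (gradient_growth_bound H (s / 2)); try lra.
    + intros t. apply Rle_trans with (1 := HNw t). unfold B. generalize (pow2_ge_0 M1). lra.
    + intros t.
      eapply Rle_trans.
      { apply (gradient_bound_half_radius f v N M1 (Mmax v s) s H); auto; try lra.
        - intros t'. apply HMv. lra.
        - intros t'. apply Mmax_ge; [intros; apply (jcont_v H) | apply (hp_v_per f v H)]. }
      set (E := exp (2 * delta * ln (s / 2))).
      assert (Hlns : 0 <= ln (s / 2)).
      { rewrite <- ln_1. left. apply ln_increasing; lra. }
      assert (HE1 : 1 <= E).
      { rewrite <- exp_0. apply exp_le_compat. apply Rmult_le_pos; lra. }
      assert (HM0 : 0 <= Mmax v s).
      { eapply Rle_trans; [apply Rabs_pos |].
        apply (Mmax_ge v s 0); [intros; apply (jcont_v H) | apply (hp_v_per f v H)]. }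
      assert (Hratio : 0 <= Mmax v s / s <= exp (delta * ln s)).
      { split; [apply Rmult_le_pos; [exact HM0 | left; apply Rinv_0_lt_compat; lra] |].
        unfold Rpower in HMs. rewrite Rmult_plus_distr_r, Rmult_1_l, exp_plus, exp_ln in HMs by lra.
        assert (Hp := exp_pos (delta * ln s)).
        apply (Rmult_lt_compat_r (exp (delta * ln s))) in HMs; [| exact Hp].
        replace (Mmax v s / (s * exp (delta * ln s)) * exp (delta * ln s))
          with (Mmax v s / s) in HMs by (field; lra).
        lra. }
      (* [s^(2 delta) = 2^(2 delta) * (s / 2)^(2 delta)], and [2^(2 delta) <= 4] because
         [delta <= 1]. *)
      assert (Hsq : (Mmax v s / s) ^ 2 <= 4 * E).
      { apply Rle_trans with (exp (delta * ln s) ^ 2); [apply pow_incr, Hratio |].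
        replace (exp (delta * ln s) ^ 2) with (exp (2 * delta * ln 2 + 2 * delta * ln (s / 2))).
        - rewrite exp_plus. fold E. apply Rmult_le_compat_r; [lra |].
          apply Rle_trans with (exp (ln 2 + ln 2)).
          + apply exp_le_compat. generalize ln_lt_2. nra.
          + rewrite exp_plus, exp_ln by lra. lra.
        - replace (exp (delta * ln s) ^ 2) with (exp (delta * ln s + delta * ln s))
            by (rewrite exp_plus; ring).
          f_equal. replace s with (2 * (s / 2)) at 2 3 by field.
          rewrite ln_mult by lra. ring. }
      assert (0 <= (2 * N + 8 * M1 ^ 2 + 2) * (E - 1)).
      { apply Rmult_le_pos; [generalize (pow2_ge_0 M1) |]; lra. }
      unfold B. lra.
  - apply Rmult_le_compat_l; [apply Rmult_le_pos; [left; apply exp_pos | exact HB] |].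
    apply exp_le_compat. lra.
Qed.

Theorem theorem4 (f u : R -> R -> R) :
  polar_metric_fun f ->
  (forall r th, 0 < r -> 0 <= gauss_curv f r th) ->
  SmoothOn whole_plane u ->
  (forall r th, 0 < r -> lap_g f (polar u) r th = 0) ->
  (forall delta, 0 < delta ->
     liminf_pinfty_eq (fun r => Mmax (polar u) r / Rpower r (1 + delta)) 0) ->
  exists C, 0 < C /\ forall r th, 0 <= r -> Rabs (polar u r th) <= C * (1 + r).
Proof.
  intros Hf HK Hu Hlap Hgrow.
  assert (H := harmonic_polar_intro f u Hf HK Hu Hlap).
  set (v := polar u) in *.
  destruct (gradient_bounded f v H) as (D & HD & HDw).
  { intros delta Hd R0. destruct (proj2 (Hgrow delta Hd) 1 Rlt_0_1 R0) as (r & Hr & Hlt).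
    exists r. split; [exact Hr | lra]. }
  (* The pullback is continuous up to [r = 0], so compactness settles the unit disc; beyond it the
     gradient bound is integrated along rays. *)
  destruct (annulus_bounded v 0 1) as (M & HM & HMv).
  { intros r th _. apply (jcont_v H). }
  { intros r _. apply (hp_v_per f v H). }
  (* [v_r ^ 2 <= D] implies [|v_r| <= D + 1], which avoids a square root. *)
  assert (Hd1 : forall r th, 1 <= r -> Rabs (d1 v r th) <= D + 1).
  { intros r th Hr. apply Rabs_le_between.
    assert (Hw := HDw r th Hr). unfold grad_sq in Hw.
    assert (Hp := hp_f_pos f v H r th ltac:(lra)).
    assert (0 <= d2 v r th ^ 2 / f r th ^ 2).
    { apply Rmult_le_pos; [apply pow2_ge_0 | left; apply Rinv_0_lt_compat, pow_lt, Hp]. }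
    split; nra. }
  exists (M + D + 1). split; [lra |]. intros r th Hr.
  destruct (Rle_lt_dec r 1) as [Hr1 | Hr1].
  - assert (Hb := HMv r th ltac:(lra)). nra.
  - destruct (MVT_cor2 (fun t => v t th) (fun t => d1 v t th) 1 r Hr1) as (c & Hc & Hc1).
    { intros t _. apply is_derive_Reals.
      eapply CkOn_is_derive1; [apply (hp_v_C3 f v H) | exact I]. }
    assert (Hb := HMv 1 th ltac:(lra)).
    assert (Hinc : Rabs (v r th - v 1 th) <= (D + 1) * (r - 1)).
    { rewrite Hc, Rabs_mult, (Rabs_right (r - 1)) by lra.
      apply Rmult_le_compat_r; [lra | apply Hd1; lra]. }
    assert (Htri := Rabs_triang (v r th - v 1 th) (v 1 th)).
    replace (v r th - v 1 th + v 1 th) with (v r th) in Htri by ring.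
    nra.
Qed.
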